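(* Let $\Delta\subset\mathbb Z^r$ be a finite subset with $g=\#\Delta$, and let $(\Lambda_0(t,z),\Lambda_1(t,z),\dots,\Lambda_l(t,z))$ be a $\Delta$-admissible tuple of Laurent polynomials in $\mathbb Z_p[x^{\pm1}]=\mathbb Z_p[t^{\pm1},z^{\pm1}]$. (i) For $0\le s\le l$ we have $$A\big(s+1,\Lambda_0(x)\Lambda_1(x)^p\cdots\Lambda_s(x)^{p^s}\big)\equiv A\big(1,\Lambda_0(x)\big)\,\sigma\big(A(1,\Lambda_1(x))\big)\cdots\sigma^s\big(A(1,\Lambda_s(x))\big)\pmod p.$$ (ii) Assume that the determinants of the matrices $A(1,\Lambda_i(t,z))$, $i=0,1,\dots,l$, are Laurent polynomials in $z$ all nonzero modulo $p$. Then for $1\le s\le l$ the determinant of the matrix $A\big(s,\Lambda_1(x)\Lambda_2(x)^p\cdots\Lambda_s(x)^{p^{s-1}}\big)$ is a Laurent polynomial nonzero modulo $p$, and we have modulo $p^s$: $$A\big(s+1,\Lambda_0(x)\Lambda_1(x)^p\cdots\Lambda_s(x)^{p^s}\big)\cdot\sigma\big(A\big(s,\Lambda_1(x)\Lambda_2(x)^p\cdots\Lambda_s(x)^{p^{s-1}}\big)\big)^{-1}$$ $$\equiv A\big(s,\Lambda_0(x)\Lambda_1(x)^p\cdots\Lambda_{s-1}(x)^{p^{s-1}}\big)\cdot\sigma\big(A\big(s-1,\Lambda_1(x)\Lambda_2(x)^p\cdots\Lambda_{s-1}(x)^{p^{s-2}}\big)\big)^{-1},$$ where for $s=1$ the second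 factor on the right is understood as the $g\times g$ identity matrix.
   Context: $p$ is an odd prime. $x=(t,z)$, where $t=(t_1,\dots,t_r)$ and $z=(z_1,\dots,z_n)$ are two groups of variables. Newton polytope: for a Laurent polynomial $F(t,z)$, $N(F)\subset\mathbb R^r$ is its Newton polytope with respect to the $t$ variables only (the convex hull of those $v\in\mathbb Z^r$ for which the coefficient of $t^v$ in $F$, a Laurent polynomial in $z$, is nonzero). Admissibility: for a finite set $\Delta\subset\mathbb Z^r$, a tuple $(N_0,\dots,N_l)$ of convex polytopes in $\mathbb R^r$ is $\Delta$-admissible if for all $0\le i\le j<l$ one has $\big(\Delta+N_i+pN_{i+1}+\dots+p^{j-i}N_j\big)\cap p^{j-i+1}\mathbb Z^r\subset p^{j-i+1}\Delta$ (Minkowski sums). A tuple $(\Lambda_0,\dots,\Lambda_l)$ of Laurent polynomials is $\Delta$-admissible if $(N(\Lambda_0),\dots,N(\Lambda_l))$ is. Hasse–Witt matrix: for $v\in\mathbb Z^r$, $\mathrm{Coeff}_vF(t,z)$ is the coefficient of $t^v$ in $F$. For $m\ge1$, $A(m,F(t,z)):=\big(\mathrm{Coeff}_{p^mv-u}F(t,z)\big)_{u\in\Delta,\,v\in\Delta}$, a $g\times g$ matrix of Laurent polynomials in $z$ ($u$ indexes rows, $v$ columns). $\sigma(G(z))=G(z^p)$ with $z^p=(z_1^p,\dots,z_n^p)$, applied to matrices entrywise. Congruences: a congruence modulo $p^s$ between Laurent polynomials with coefficients in $\mathbb Z_p$ means that all coefficients of the difference are divisible by $p^s$. For $g\times g$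 matrices $F_1,F_2,G_1,G_2$ over $\mathbb Z_p[z^{\pm1}]$ with $\det F_2,\det G_2$ nonzero modulo $p$, the congruence $F_1F_2^{-1}\equiv G_1G_2^{-1}\pmod{p^s}$ means: writing (Cramer's rule) $F_1F_2^{-1}=F\cdot\frac1{\det F_2}$, $G_1G_2^{-1}=G\cdot\frac1{\det G_2}$ with $F,G$ matrices over $\mathbb Z_p[z^{\pm1}]$, one has $F\cdot\det G_2\equiv G\cdot\det F_2\pmod{p^s}$. *)

(* Defs.v *)
From HB Require Import structures.
From mathcomp Require Import all_boot all_order all_algebra finmap.
From mathcomp Require Import boolp classical_sets reals convex.

Set Implicit Arguments.
Unset Strict Implicit.
Unset Printing Implicit Defensive.

Import Order.TTheory GRing.Theory Num.Theory.

Local Open Scope ring_scope.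

(* The ring Z_p, as the inverse limit of the Z/p^k: an element is given by its
   least non-negative residues modulo p^k.  The single condition below says
   both that [res k] lies in [0, p^k[ and that residues are compatible. *)
Record padic_int (p : nat) (p_pr : prime p) := PadicInt {
  res : nat -> int;
  resP : forall k, (res k.+1 %% (p ^ k)%N%:Z)%Z = res k
}.

HB.instance Definition _ p (p_pr : prime p) :=
  gen_eqMixin (padic_int p_pr).
HB.instance Definition _ p (p_pr : prime p) :=
  gen_choiceMixin (padic_int p_pr).

Section PadicInt.
Variables (p : nat) (p_pr : prime p).
Local Notation Zp := (padic_int p_pr).
Local Notation "m %%_ k" := (m %% (p ^ k)%N%:Z)%Z (at level 40).

Lemma padic_intP (x y : Zp) : res x =1 res y -> x = y.
Proof.
case: x y => [x xP] [y yP] /= /funext exy; move: xP yP; rewrite exy => xP yP.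
by congr PadicInt; exact: Prop_irrelevance.
Qed.

Lemma modpSk (m : int) k : (m %%_ k.+1) %%_ k = m %%_ k.
Proof.
have [q ->] : exists q, m %%_ k.+1 = q * (p ^ k)%N%:Z + m.
  exists (- ((m %/ (p ^ k.+1)%N%:Z)%Z * p%:Z)).
  by rewrite /modz expnS PoszM mulNr mulrA addrC.
by rewrite modzMDl.
Qed.

Lemma res_mod (x : Zp) k : res x k %%_ k = res x k.
Proof. by rewrite -resP modz_mod. Qed.

Definition padic_of_seq (u : nat -> int)
    (uP : forall k, u k.+1 %%_ k = u k %%_ k) : Zp :=
  @PadicInt p p_pr (fun k => u k %%_ k)
    (fun k => etrans (modpSk (u k.+1) k) (uP k)).

Lemma resS (x : Zp) k : res x k.+1 %%_ k = res x k %%_ k.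
Proof. by rewrite resP res_mod. Qed.

Lemma padic_zero_subproof k : (0 : int) %%_ k = 0 %%_ k. Proof. by []. Qed.
Lemma padic_one_subproof k : (1 : int) %%_ k = 1 %%_ k. Proof. by []. Qed.
Lemma padic_opp_subproof (x : Zp) k :
  (- res x k.+1) %%_ k = (- res x k) %%_ k.
Proof. by rewrite -modzNm resS modzNm. Qed.
Lemma padic_add_subproof (x y : Zp) k :
  (res x k.+1 + res y k.+1) %%_ k = (res x k + res y k) %%_ k.
Proof. by rewrite -modzDm !resS modzDm. Qed.
Lemma padic_mul_subproof (x y : Zp) k :
  (res x k.+1 * res y k.+1) %%_ k = (res x k * res y k) %%_ k.
Proof. by rewrite -modzMm !resS modzMm. Qed.

Definition padic_zero := padic_of_seq padic_zero_subproof.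
Definition padic_one := padic_of_seq padic_one_subproof.
Definition padic_opp x := padic_of_seq (padic_opp_subproof x).
Definition padic_add x y := padic_of_seq (padic_add_subproof x y).
Definition padic_mul x y := padic_of_seq (padic_mul_subproof x y).

Lemma padic_addA : associative padic_add.
Proof. by move=> x y z; apply: padic_intP => k /=; rewrite modzDmr modzDml addrA. Qed.
Lemma padic_addC : commutative padic_add.
Proof. by move=> x y; apply: padic_intP => k /=; rewrite addrC. Qed.
Lemma padic_add0 : left_id padic_zero padic_add.
Proof. by move=> x; apply: padic_intP => k /=; rewrite modzDml add0r res_mod. Qed.
Lemma padic_addN : left_inverse padic_zero padic_opp padic_add.
Proof. by move=> x; apply: padic_intP => k /=; rewrite modzDml addNr. Qed.

HB.instance Definition _ :=
  GRing.isZmodule.Build Zp padic_addA padic_addC padic_add0 padic_addN.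

Lemma padic_mulA : associative padic_mul.
Proof. by move=> x y z; apply: padic_intP => k /=; rewrite modzMmr modzMml mulrA. Qed.
Lemma padic_mulC : commutative padic_mul.
Proof. by move=> x y; apply: padic_intP => k /=; rewrite mulrC. Qed.
Lemma padic_mul1 : left_id padic_one padic_mul.
Proof. by move=> x; apply: padic_intP => k /=; rewrite modzMml mul1r res_mod. Qed.
Lemma padic_mulDl : left_distributive padic_mul padic_add.
Proof.
by move=> x y z; apply: padic_intP => k /=; rewrite modzMml modzDm mulrDl.
Qed.
Lemma padic_one_neq0 : padic_one != 0.
Proof.
apply/eqP => /(congr1 (fun x : Zp => res x 1)) /=.
by rewrite expn1 mod0z modz_small //= ltz_nat prime_gt1.
Qed.

HB.instance Definition _ := GRing.Zmodule_isComNzRing.Build Zp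
  padic_mulA padic_mulC padic_mul1 padic_mulDl padic_one_neq0.

End PadicInt.

(* Laurent polynomials in k variables over R: the group algebra of Z^k, with
   [f m] the coefficient of the monomial of exponent [m]. *)
Definition laurent (R : comNzRingType) (k : nat) :=
  {fsfun 'rV[int]_k -> R with 0}.

HB.instance Definition _ (R : comNzRingType) (k : nat) :=
  Choice.on (laurent R k).

Section Laurent.
Variables (R : comNzRingType) (k : nat).
Local Notation K := 'rV[int]_k.
Local Notation L := (laurent R k).
Local Open Scope fset_scope.
Local Open Scope ring_scope.
Implicit Types (f g h : L) (a b m : K) (x y : R) (D E : {fset K}).

Definition laurent_zero : L := [fsfun].
Definition laurent_opp f : L := [fsfun m in finsupp f => - f m].
Definition laurent_add f g : L :=
  [fsfun m in finsupp f `|` finsupp g => f m + g m].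

Lemma laurent_zeroE m : laurent_zero m = 0.
Proof. by rewrite fsfunE. Qed.
Lemma laurent_oppE f m : laurent_opp f m = - f m.
Proof. by rewrite fsfunE; case: finsuppP => // _; rewrite oppr0. Qed.
Lemma laurent_addE f g m : laurent_add f g m = f m + g m.
Proof.
by rewrite fsfunE inE; case: finsuppP => _; case: finsuppP => _ //=; rewrite addr0.
Qed.

Lemma laurent_addA : associative laurent_add.
Proof. by move=> f g h; apply/fsfunP => m; rewrite !laurent_addE addrA. Qed.
Lemma laurent_addC : commutative laurent_add.
Proof. by move=> f g; apply/fsfunP => m; rewrite !laurent_addE addrC. Qed.
Lemma laurent_add0 : left_id laurent_zero laurent_add.
Proof. by move=> f; apply/fsfunP => m; rewrite laurent_addE laurent_zeroE add0r. Qed.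
Lemma laurent_addN : left_inverse laurent_zero laurent_opp laurent_add.
Proof.
by move=> f; apply/fsfunP => m; rewrite laurent_addE laurent_oppE laurent_zeroE addNr.
Qed.

HB.instance Definition _ :=
  GRing.isZmodule.Build L laurent_addA laurent_addC laurent_add0 laurent_addN.

Lemma laurent0 m : (0 : L) m = 0. Proof. exact: laurent_zeroE. Qed.
Lemma laurentD f g m : (f + g) m = f m + g m. Proof. exact: laurent_addE. Qed.
Lemma laurentN f m : (- f) m = - f m. Proof. exact: laurent_oppE. Qed.
Lemma laurent_sum (I : Type) (s : seq I) (P : pred I) (F : I -> L) m :
  (\sum_(i <- s | P i) F i) m = \sum_(i <- s | P i) F i m.
Proof.
by apply: (big_morph (fun f : L => f m)); [move=> f g; exact: laurentD | exact: laurent0].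
Qed.

Definition mono a x : L := [fsfun m in [fset a] => x].

Lemma monoE a x m : mono a x m = if m == a then x else 0.
Proof. by rewrite fsfunE inE. Qed.
Lemma mono0 a : mono a 0 = 0.
Proof. by apply/fsfunP => m; rewrite monoE laurent0; case: eqP. Qed.
Lemma monoD a x y : mono a (x + y) = mono a x + mono a y.
Proof.
by apply/fsfunP => m; rewrite laurentD !monoE; case: eqP => // _; rewrite addr0.
Qed.

Lemma laurent_expand f D : finsupp f `<=` D -> f = \sum_(a <- D) mono a (f a).
Proof.
move=> fD; apply/fsfunP => m; rewrite laurent_sum.
have [mD|mD] := boolP (m \in D).
  rewrite (big_fsetD1 m) //= monoE eqxx big_seq big1 ?addr0 // => a.
  by rewrite !inE monoE eq_sym => /andP[/negPf->].
rewrite big_seq big1 => [|a aD]; last first.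
  by rewrite monoE; case: eqP => // ma; rewrite ma aD in mD.
by apply: fsfun_dflt; apply: contra mD; exact: (fsubsetP fD).
Qed.

Definition laurent_one : L := mono 0 1.
Definition laurent_mul f g : L :=
  \sum_(a <- finsupp f) \sum_(b <- finsupp g) mono (a + b) (f a * g b).

Lemma laurent_mulw f g D E : finsupp f `<=` D -> finsupp g `<=` E ->
  laurent_mul f g = \sum_(a <- D) \sum_(b <- E) mono (a + b) (f a * g b).
Proof.
move=> fD gE; rewrite /laurent_mul (big_fset_incl _ fD) /=; last first.
  move=> a _ af; rewrite big1 // => b _.
  by rewrite (fsfun_dflt af) mul0r mono0.
apply: eq_bigr => a _; rewrite (big_fset_incl _ gE) //= => b _ bg.
by rewrite (fsfun_dflt bg) mulr0 mono0.
Qed.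

Lemma laurent_mulC : commutative laurent_mul.
Proof.
move=> f g; rewrite /laurent_mul exchange_big /=.
by apply: eq_bigr => a _; apply: eq_bigr => b _; rewrite addrC mulrC.
Qed.

Lemma laurent_mulDl : left_distributive laurent_mul +%R.
Proof.
move=> f g h; pose D := finsupp f `|` finsupp g `|` finsupp (f + g).
have fD : finsupp f `<=` D by rewrite /D -fsetUA fsubsetUl.
have gD : finsupp g `<=` D by rewrite /D fsetUAC fsubsetUr.
have fgD : finsupp (f + g) `<=` D by rewrite /D fsubsetUr.
rewrite (laurent_mulw fD (fsubset_refl _)) (laurent_mulw gD (fsubset_refl _)).
rewrite (laurent_mulw fgD (fsubset_refl _)) -big_split /=.
apply: eq_bigr => a _; rewrite -big_split /=; apply: eq_bigr => b _.
by rewrite laurentD mulrDl monoD.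
Qed.

Lemma laurent_mulDr : right_distributive laurent_mul +%R.
Proof. by move=> f g h; rewrite !(laurent_mulC f) laurent_mulDl. Qed.

Lemma laurent_mul0 f : laurent_mul f 0 = 0.
Proof. by apply: (addrI (laurent_mul f 0)); rewrite -laurent_mulDr !addr0. Qed.

Lemma mul0_laurent f : laurent_mul 0 f = 0.
Proof. by rewrite laurent_mulC laurent_mul0. Qed.

Lemma finsupp_mono a x : finsupp (mono a x) `<=` [fset a].
Proof. exact: finsupp_sub. Qed.

Lemma laurent_mulUU a b x y :
  laurent_mul (mono a x) (mono b y) = mono (a + b) (x * y).
Proof.
rewrite (laurent_mulw (finsupp_mono a x) (finsupp_mono b y)).
by rewrite !big_seq_fset1 !monoE !eqxx.
Qed.

Lemma laurent_ind (P : L -> Prop) : P 0 ->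
  (forall f g, P f -> P g -> P (f + g)) -> (forall a x, P (mono a x)) ->
  forall f, P f.
Proof.
by move=> P0 PD PU f; rewrite (laurent_expand (fsubset_refl (finsupp f))); apply: big_ind.
Qed.

Lemma laurent_mulA : associative laurent_mul.
Proof.
move=> f g h; move: f; apply: laurent_ind => [|f f' IH IH'|a x].
- by rewrite !mul0_laurent.
- by rewrite !laurent_mulDl IH IH'.
move: g; apply: laurent_ind => [|g g' IH IH'|b y].
- by rewrite !(mul0_laurent, laurent_mul0).
- by rewrite !(laurent_mulDl, laurent_mulDr) IH IH'.
move: h; apply: laurent_ind => [|h h' IH IH'|c z].
- by rewrite !laurent_mul0.
- by rewrite !laurent_mulDr IH IH'.
by rewrite !laurent_mulUU addrA mulrA.
Qed.

Lemma laurent_mul1 : left_id laurent_one laurent_mul.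
Proof.
apply: laurent_ind => [|f g IHf IHg|a x]; first by rewrite laurent_mul0.
  by rewrite laurent_mulDr IHf IHg.
by rewrite laurent_mulUU add0r mul1r.
Qed.

Lemma laurent_one_neq0 : laurent_one != 0.
Proof.
apply/eqP => /(congr1 (fun f : L => f 0)) /eqP.
by rewrite monoE eqxx laurent0 oner_eq0.
Qed.

HB.instance Definition _ := GRing.Zmodule_isComNzRing.Build L
  laurent_mulA laurent_mulC laurent_mul1 laurent_mulDl laurent_one_neq0.

(* G(z) |-> G(z_1^p, ..., z_k^p) *)
Definition frob (p : nat) f : L := \sum_(a <- finsupp f) mono (a *+ p) (f a).

End Laurent.

Notation zlaurent p_pr n := (laurent (padic_int p_pr) n).

(* Z_p[t^{+-1}, z^{+-1}], as Laurent polynomials in t with coefficients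
   in Z_p[z^{+-1}]; thus [F v] is Coeff_v F. *)
Notation xlaurent p_pr r n := (laurent (zlaurent p_pr n) r).

Section Dwork.
Variables (p : nat) (p_pr : prime p) (r n : nat).
Local Notation zlaurent := (zlaurent p_pr n).
Local Notation xlaurent := (xlaurent p_pr r n).

Definition real_vec (R : realType) (v : 'rV[int]_r) : 'rV[R]_r := map_mx intr v.

Local Open Scope classical_set_scope.

Definition newton_polytope (R : realType) (F : xlaurent) : set 'rV[R]_r :=
  smallest (@convex_set R 'rV[R]_r) [set real_vec R v | v in [set v | F v != 0]].

Definition minkowski (R : realType) (A B : set 'rV[R]_r) : set 'rV[R]_r :=
  [set a + b | a in A & b in B].

Definition dilate (R : realType) (c : R) (A : set 'rV[R]_r) : set 'rV[R]_r :=
  [set c *: a | a in A].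

(* N_i + p N_{i+1} + ... + p^(j-i) N_j *)
Definition weighted_sum (R : realType) (N : nat -> set 'rV[R]_r) (i j : nat) :=
  \big[@minkowski R/[set 0]]_(i <= k < j.+1) dilate (p ^ (k - i))%:R (N k).

Definition admissible (R : realType) (Delta : {fset 'rV[int]_r}) (l : nat)
    (N : l.+1.-tuple (set 'rV[R]_r)) : Prop :=
  let D := [set real_vec R u | u in [set` Delta]] in
  forall i j : nat, (i <= j)%N -> (j < l)%N ->
    minkowski D (weighted_sum (nth set0 N) i j)
      `&` dilate (p ^ (j - i).+1)%:R (range (real_vec R))
    `<=` dilate (p ^ (j - i).+1)%:R D.

Local Close Scope classical_set_scope.

Definition admissible_polys (R : realType) (Delta : {fset 'rV[int]_r}) (l : nat)
    (Lam : l.+1.-tuple xlaurent) : Prop :=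
  admissible Delta [tuple of map (@newton_polytope R) Lam].

Definition hasse_witt (Delta : {fset 'rV[int]_r}) (m : nat) (F : xlaurent) :
    'M[zlaurent]_(#|` Delta|) :=
  \matrix_(i, j) F (Delta`_j *+ p ^ m - Delta`_i).

(* Lam_a Lam_{a+1}^p ... Lam_{b-1}^(p^(b-1-a)) *)
Definition twisted_prod (Lam : seq xlaurent) (a b : nat) : xlaurent :=
  \prod_(a <= k < b) Lam`_k ^+ (p ^ (k - a)).

Definition sigma : zlaurent -> zlaurent := @frob (padic_int p_pr) n p.

Definition sigma_mx (g k : nat) (M : 'M[zlaurent]_g) : 'M[zlaurent]_g :=
  map_mx (iter k sigma) M.

Definition eqmod (s : nat) (f g : zlaurent) : Prop :=
  forall w, exists c : padic_int p_pr, (f - g) w = (p ^ s)%:R * c.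

Definition eqmod_mx (s g : nat) (F G : 'M[zlaurent]_g) : Prop :=
  forall i j, eqmod s (F i j) (G i j).

Definition nonzero_modp (f : zlaurent) : Prop := ~ eqmod 1 f 0.

(* F1 F2^-1 = G1 G2^-1 mod p^s, with F2^-1 = (\det F2)^-1 \adj F2 (Cramer) *)
Definition frac_eqmod (s g : nat) (F1 F2 G1 G2 : 'M[zlaurent]_g) : Prop :=
  [/\ nonzero_modp (\det F2), nonzero_modp (\det G2) &
      eqmod_mx s (\det G2 *: (F1 *m \adj F2)) (\det F2 *: (G1 *m \adj G2))].

End Dwork.

(* Main.v *)
(* Write [T a m] for Lam_a Lam_{a+1}^p ... Lam_{a+m-1}^(p^(m-1)) and F(x^(p^j))
   for the Frobenius twist of F in all variables x = (t, z).  Ghost terms G_j are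
   defined by successive subtraction, so that
     T a m (x) = \sum_(j < m) G_j(x) * T (a+j+1) (m-j-1) (x^(p^(j+1))).
   Since F^(p^s) = F(x^(p^j))^(p^(s-j)) modulo p^(s-j+1), p^j divides G_j; and the
   support of G_j lies in N_a + p N_(a+1) + ... + p^j N_(a+j).  Admissibility then
   says that only exponents of p^(j+1) Delta contribute when one takes Hasse-Witt
   coefficients, so with H a m = A(m, T a m) and B_j = A(j+1, G_j),
     H a m = \sum_(j < m) B_j * sigma^(j+1) (H (a+j+1) (m-j-1)),  p^j | B_j.
   Part (i) is this identity modulo p.  For (ii), induction on s gives the
   congruences of the quotients C_i C_(i+1)^-1 = D_i D_(i+1)^-1 modulo p^(s-i),
   with C_i = sigma^i (H (a+i) (s+1-i)) and D_i = sigma^i (H (a+i) (s-i));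
   composing them, C_j C_1^-1 = D_j D_1^-1 modulo p^(s-j+1), and the missing factor
   p^(j-1) is provided by B_(j-1). *)

Require Import Defs.
From HB Require Import structures.
From mathcomp Require Import all_boot all_order all_algebra finmap.
From mathcomp Require Import interval_inference zify ring.
From mathcomp Require Import boolp classical_sets reals convex.

Set Implicit Arguments.
Unset Strict Implicit.
Unset Printing Implicit Defensive.

Import Order.TTheory GRing.Theory Num.Theory.

Local Open Scope ring_scope.

(** * Divisibility by powers of [p] in a commutative ring *)

Section Pdvd.
Variables (R : comNzRingType) (p : nat).
Implicit Types (k l : nat) (x y : R).

Definition pdvd k x := exists c, x = (p ^ k)%:R * c.

Lemma pdvd_n0 x : pdvd 0 x. Proof. by exists x; rewrite mul1r. Qed.
Lemma pdvd0 k : pdvd k 0. Proof. by exists 0; rewrite mulr0. Qed.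
Lemma pdvdD k x y : pdvd k x -> pdvd k y -> pdvd k (x + y).
Proof. by case=> c -> [d ->]; exists (c + d); rewrite mulrDr. Qed.
Lemma pdvdN k x : pdvd k x -> pdvd k (- x).
Proof. by case=> c ->; exists (- c); rewrite mulrN. Qed.
Lemma pdvdB k x y : pdvd k x -> pdvd k y -> pdvd k (x - y).
Proof. by move=> xk yk; apply: pdvdD => //; apply: pdvdN. Qed.
Lemma pdvdM k l x y : pdvd k x -> pdvd l y -> pdvd (k + l) (x * y).
Proof.
by case=> c -> [d ->]; exists (c * d); rewrite expnD natrM mulrACA.
Qed.
Lemma pdvdMr k x y : pdvd k x -> pdvd k (x * y).
Proof. by move=> xk; rewrite -[k]addn0; apply: pdvdM => //; exact: pdvd_n0. Qed.
Lemma pdvdMl k x y : pdvd k y -> pdvd k (x * y).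
Proof. by rewrite mulrC; exact: pdvdMr. Qed.
Lemma pdvdW l k x : (k <= l)%N -> pdvd l x -> pdvd k x.
Proof.
move=> /subnKC<- [c ->]; exists ((p ^ (l - k))%:R * c).
by rewrite expnD natrM mulrA.
Qed.
Lemma pdvd_sum k (I : Type) (s : seq I) (P : pred I) (F : I -> R) :
  (forall i, P i -> pdvd k (F i)) -> pdvd k (\sum_(i <- s | P i) F i).
Proof. by move=> PF; apply: big_ind => //; [exact: pdvd0 | exact: pdvdD]. Qed.
Lemma pdvd_natr m : (p %| m)%N -> pdvd 1 (m%:R : R).
Proof. by move=> /dvdnP[q ->]; exists q%:R; rewrite mulnC natrM. Qed.
Lemma pdvd_trans k x y z : pdvd k (x - y) -> pdvd k (y - z) -> pdvd k (x - z).
Proof. by move=> xy yz; rewrite -(subrKA y); exact: pdvdD. Qed.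
Lemma pdvdB_mul k x x' y y' :
  pdvd k (x - x') -> pdvd k (y - y') -> pdvd k (x * y - x' * y').
Proof.
move=> xx yy; have -> : x * y - x' * y' = (x - x') * y + x' * (y - y').
  by rewrite mulrBl mulrBr addrA subrK.
by apply: pdvdD; [exact: pdvdMr | exact: pdvdMl].
Qed.
Lemma pdvdB_add k x x' y y' :
  pdvd k (x - x') -> pdvd k (y - y') -> pdvd k ((x + y) - (x' + y')).
Proof. by move=> xx yy; rewrite opprD addrACA; exact: pdvdD. Qed.
Lemma pdvdB_exp k m x y : pdvd k (x - y) -> pdvd k (x ^+ m - y ^+ m).
Proof. by move=> xy; rewrite subrXX; exact: pdvdMr. Qed.

(** Since [x] and [y] agree modulo [p], the cofactor of [x - y] in [x ^+ p - y ^+ p] is congruent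
    modulo [p] to [p%:R * y ^+ p.-1]; this is the extra factor [p]. *)
Lemma pdvd_exp_p k x y :
  pdvd k.+1 (x - y) -> pdvd k.+2 (x ^+ p - y ^+ p).
Proof.
move=> xy; rewrite subrXX -[k.+2]addn1; apply: pdvdM => //.
have sum_y : \sum_(i < p) y ^+ (p.-1 - i) * y ^+ i = p%:R * y ^+ p.-1.
  rewrite (eq_bigr (fun=> y ^+ p.-1)) => [|i _].
    by rewrite sumr_const card_ord mulr_natl.
  have ip : (i <= p.-1)%N by rewrite -ltnS (ltn_predK (ltn_ord i)).
  by rewrite -exprD subnK.
rewrite -[X in pdvd _ X](subrK (p%:R * y ^+ p.-1)).
apply: pdvdD; last by apply: pdvdMr; exact: pdvd_natr.
rewrite -sum_y -sumrB; apply: pdvd_sum => i _.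
by rewrite -mulrBl; apply/pdvdMr/pdvdB_exp; exact: pdvdW xy.
Qed.

Lemma pdvd_exp_pn m x y :
  pdvd 1 (x - y) -> pdvd m.+1 (x ^+ (p ^ m) - y ^+ (p ^ m)).
Proof.
move=> xy; elim: m => [|m IH]; first by rewrite expn0 !expr1.
by rewrite expnSr !exprM; exact: pdvd_exp_p.
Qed.

(** Factors [p] are stripped from [y] one at a time: primality of [p] yields [y = p z], and
    regularity of [p] removes that factor from the divisibility of [x * y]. *)
Lemma pdvd_cancel : (forall x, p%:R * x = 0 -> x = 0) ->
  (forall x y, pdvd 1 (x * y) -> pdvd 1 x \/ pdvd 1 y) ->
  forall k x y, ~ pdvd 1 x -> pdvd k (x * y) -> pdvd k y.
Proof.
move=> reg prim; elim=> [|k IH] x y xN xy; first exact: pdvd_n0.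
have [//|[z yE]] := prim _ _ (pdvdW (ltn0Sn k) xy).
rewrite yE -add1n; apply: pdvdM; first by exists 1; rewrite mulr1.
apply: IH xN _; case: xy => c xyE; exists c; apply/eqP; rewrite -subr_eq0.
apply/eqP/reg; rewrite mulrBr mulrCA [p%:R * (_ * c)]mulrA -natrM -expnS.
by rewrite -xyE yE expn1 subrr.
Qed.

Hypothesis p_pr : prime p.

Lemma pdvd_expD x y : pdvd 1 ((x + y) ^+ p - (x ^+ p + y ^+ p)).
Proof.
have [q pE] : exists q, p = q.+1 by exists p.-1; rewrite prednK ?prime_gt0.
rewrite exprDn pE.
rewrite big_ord_recl big_ord_recr /= subn0 bin0 subnn binn !expr0 mulr1 mul1r.
rewrite !mulr1n addrA addrAC [_ + y ^+ _]addrC.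
rewrite [X in pdvd 1 X]addrAC [y ^+ _ + _]addrC subrr add0r.
apply: pdvd_sum => i _; rewrite -mulr_natl; apply/pdvdMr/pdvd_natr.
by rewrite -pE prime_dvd_bin // pE /bump /= add1n ltnS ltn_ord.
Qed.

End Pdvd.

Section PdvdMorph.
Variables (R S : comNzRingType) (p : nat) (f : {rmorphism R -> S}).

Lemma pdvd_rmorph k x : pdvd p k x -> pdvd p k (f x).
Proof. by case=> c ->; exists (f c); rewrite rmorphM rmorph_nat. Qed.

End PdvdMorph.

(** * Arithmetic of p-adic integers through their residues *)

Section PadicPdvd.
Variables (p : nat) (p_pr : prime p).
Local Notation Zp := (padic_int p_pr).
Implicit Types x y : Zp.

Lemma res_natr m k : res (m%:R : Zp) k = (m%:Z %% (p ^ k)%N%:Z)%Z.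
Proof.
elim: m => [//|m IH].
by rewrite -addn1 natrD PoszD /= IH /= modzDm.
Qed.

Lemma resM x y k : res (x * y) k = ((res x k * res y k) %% (p ^ k)%N%:Z)%Z.
Proof. by []. Qed.

Lemma modz_modD (m : int) k s :
  ((m %% (p ^ (k + s))%N%:Z)%Z %% (p ^ k)%N%:Z)%Z = (m %% (p ^ k)%N%:Z)%Z.
Proof.
rewrite [in RHS](divz_eq m (p ^ (k + s))%N%:Z).
by rewrite expnD PoszM [_ * _%:Z]mulrC mulrA modzMDl.
Qed.

Lemma res_resD x k s : (res x (k + s) %% (p ^ k)%N%:Z)%Z = res x k.
Proof.
elim: s => [|s IH]; first by rewrite addn0 res_mod.
by rewrite addnS -(modz_modD _ k s) resP.
Qed.

Lemma pexpz_gt0 k : 0 < (p ^ k)%N%:Z.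
Proof. by rewrite ltz_nat expn_gt0 prime_gt0. Qed.

Lemma pdvd_padicP s x : pdvd p s x <-> res x s = 0.
Proof.
split=> [[c ->]|xs0].
  by rewrite resM res_natr modzz mul0r mod0z.
(* Residues of the quotient of [x] by [p ^ s]: modulo [p ^ k] it is determined by [x] modulo
   [p ^ (k + s)]. *)
pose u k := (res x (k + s) %/ (p ^ s)%N%:Z)%Z.
have uE k : (p ^ s)%N%:Z * u k = res x (k + s).
  by rewrite mulrC divzK //; apply/dvdz_mod0P; rewrite addnC res_resD.
have uP k : (u k.+1 %% (p ^ k)%N%:Z)%Z = u k.
  have ps_neq0 : (p ^ s)%N%:Z != 0 by rewrite gt_eqF ?pexpz_gt0.
  apply: (mulfI ps_neq0); rewrite (mulz_modr (pexpz_gt0 s)) !uE -PoszM -expnD.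
  by rewrite addSn addnC addnC resP.
exists (PadicInt p_pr uP); apply: padic_intP => k.
by rewrite resM res_natr modzMml /= uE res_resD.
Qed.

(** The residue of [p%:R * x] modulo [p ^ k.+1] is [p] times the residue of [x] modulo [p ^ k]. *)
Lemma padic_natr_reg x : p%:R * x = 0 -> x = 0.
Proof.
move=> px0; apply: padic_intP => k.
have /eqP : res (p%:R * x) k.+1 = 0 by rewrite px0 /= mod0z.
rewrite resM res_natr modzMml expnS PoszM -mulz_modr ?ltz_nat ?prime_gt0 //.
rewrite resP mulf_eq0 eqz_nat eqn0Ngt prime_gt0 //= => /eqP->.
by rewrite mod0z.
Qed.

Lemma padic_prime x y : pdvd p 1 (x * y) -> pdvd p 1 x \/ pdvd p 1 y.
Proof.
have resE (z : Zp) : pdvd p 1 z <-> (p %| `|res z 1|)%N.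
  apply: (iff_trans (pdvd_padicP 1 z)); rewrite -[res z 1]res_mod expn1.
  split=> [z0|]; last by move/(@dvdz_mod0P p%:Z); rewrite modz_mod.
  by apply/(@dvdz_mod0P p%:Z); rewrite modz_mod.
rewrite !resE resM expn1 => /(@dvdz_mod0P p%:Z); rewrite modz_mod.
by move/(@dvdz_mod0P p%:Z); rewrite dvdzE abszM Euclid_dvdM // => /orP.
Qed.

Lemma res_exp x m k : res (x ^+ m) k = (res x k ^+ m %% (p ^ k)%N%:Z)%Z.
Proof.
elim: m => [//|m IH].
by rewrite !exprS resM IH modzMmr.
Qed.

Lemma padic_fermat x : pdvd p 1 (x ^+ p - x).
Proof.
apply/pdvd_padicP => /=.
(* The residue is nonnegative, so Fermat's little theorem for natural numbers applies to it. *)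
have [m xm] : exists m : nat, res x 1 = m.
  exists `|res x 1|%N; rewrite gez0_abs // -res_mod.
  by rewrite modz_ge0 // gt_eqF ?pexpz_gt0.
rewrite res_exp xm modzDm; apply/dvdz_mod0P; rewrite -eqz_mod_dvd -rmorphXn expn1.
by rewrite !modz_nat eqz_nat fermat_little.
Qed.

End PadicPdvd.

(** * Coefficients of products and coefficientwise divisibility of Laurent polynomials *)

Section LaurentPdvd.
Variables (R : comNzRingType) (n : nat).
Local Notation L := (laurent R n).
Implicit Types (f g : L) (a b m : 'rV[int]_n) (x : R).

Lemma laurent_natM k f m : (k%:R * f) m = k%:R * f m.
Proof.
rewrite !mulr_natl; elim: k => [|k IH]; first by rewrite laurent0.
by rewrite !mulrS laurentD IH.
Qed.

Lemma mono1 : mono 0 1 = 1 :> L. Proof. by []. Qed.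

Lemma mulUU a b x y : mono a x * mono b y = mono (a + b) (x * y) :> L.
Proof. exact: laurent_mulUU. Qed.

Lemma mono_exp a x k : mono a x ^+ k = mono (a *+ k) (x ^+ k) :> L.
Proof.
elim: k => [|k IH]; first by rewrite !expr0 mulr0n mono1.
by rewrite !exprS IH mulUU mulrS.
Qed.

(** The hypothesis covers [m] outside the support, where the sum has no term to select. *)
Lemma finsupp_sum_eq (T : nmodType) (F : 'rV[int]_n -> T) f m :
  (f m = 0 -> F m = 0) ->
  \sum_(a <- finsupp f) (if a == m then F a else 0) = F m.
Proof.
move=> Fm; have [mf|mf] := boolP (m \in finsupp f).
  rewrite (big_fsetD1 _ mf) /= eqxx big_seq big1 ?addr0 // => a.
  by rewrite !inE => /andP[/negPf->].
rewrite big_seq big1 => [|a af]; first by rewrite Fm ?fsfun_dflt.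
by case: eqP => // am; rewrite -am af in mf.
Qed.

Lemma laurent_mulE f g m :
  (f * g) m = \sum_(a <- finsupp f) f a * g (m - a).
Proof.
rewrite [f * g]/(laurent_mul f g) /laurent_mul laurent_sum.
apply: eq_bigr => a _; rewrite laurent_sum.
transitivity (\sum_(b <- finsupp g) if b == m - a then f a * g b else 0).
  apply: eq_bigr => b _; rewrite monoE eq_sym.
  by rewrite -[b == _](inj_eq (addrI a)) subrKC.
by rewrite finsupp_sum_eq // => ->; rewrite mulr0.
Qed.

Lemma laurent_mul_monoE f b x m : (f * mono b x) m = f (m - b) * x.
Proof.
rewrite mulrC laurent_mulE (big_fset_incl _ (finsupp_mono b x)) /=.
  by rewrite big_seq_fset1 monoE eqxx mulrC.
by move=> c _ cb; rewrite (fsfun_dflt cb) mul0r.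
Qed.

Lemma laurent_mul_supp f g m : (f * g) m != 0 ->
  exists2 a, f a != 0 & g (m - a) != 0.
Proof.
move=> fgm; apply: contrapT => Nex; case/eqP: fgm.
rewrite laurent_mulE big1 // => a _.
have [->|fa] := eqVneq (f a) 0; first by rewrite mul0r.
have [->|gm] := eqVneq (g (m - a)) 0; first by rewrite mulr0.
by case: Nex; exists a.
Qed.

Variable p : nat.

Lemma laurent_pdvdP k f : pdvd p k f <-> forall m, pdvd p k (f m).
Proof.
split=> [[c ->] m|/choice[c cP]]; first by exists (c m); rewrite laurent_natM.
(* The chosen quotients need not vanish where [f] does; restricting them to the support of [f] makes
   their support finite. *)
exists [fsfun m in finsupp f => c m]; apply/fsfunP => m.
rewrite laurent_natM fsfunE; case: finsuppP => [_|_].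
  by rewrite mulr0.
by rewrite -cP.
Qed.

Lemma laurent_natr_reg : (forall x, p%:R * x = 0 -> x = 0) ->
  forall f, p%:R * f = 0 -> f = 0.
Proof.
move=> reg f pf0; apply/fsfunP => m; rewrite laurent0; apply: reg.
by rewrite -laurent_natM pf0 laurent0.
Qed.

End LaurentPdvd.

(** * Gauss's lemma: [p] stays prime in Laurent polynomial rings *)

Lemma seq_argmax (T : eqType) (s : seq T) (F : T -> int) : s != [::] ->
  exists2 x, x \in s & forall y, y \in s -> F y <= F x.
Proof.
elim: s => // x [|z s] IH _.
  by exists x => [|y]; rewrite inE // => /eqP->.
have [//|y ys yM] := IH; have [xy|yx] := leP (F x) (F y).
  exists y => [|w]; first by rewrite inE ys orbT.
  by rewrite inE => /predU1P[->//|/yM].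
exists x => [|w]; first by rewrite mem_head.
by rewrite inE => /predU1P[->//|/yM /le_trans]; apply; exact: ltW.
Qed.

Section UniqueSum.
Variable n : nat.
Implicit Types (a b : 'rV[int]_n).

Definition sqnorm a : int := \sum_i a 0 i ^+ 2.

Lemma sqnorm_gt0 a : a != 0 -> 0 < sqnorm a.
Proof.
move=> a0; rewrite lt_def sumr_ge0 => [|i _]; last exact: sqr_ge0.
rewrite andbT; apply: contra a0 => /eqP/psumr_eq0P a0.
apply/eqP/rowP => i; rewrite mxE; apply/eqP.
by rewrite -sqrf_eq0 a0 // => j _; exact: sqr_ge0.
Qed.

Lemma sqnorm_parallelogram a b :
  sqnorm (a + b) + sqnorm (a - b) = (sqnorm a + sqnorm b) *+ 2.
Proof.
rewrite /sqnorm -!big_split -sumrMnl /=; apply: eq_bigr => i _.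
by rewrite !mxE sqrrD sqrrB addrACA -addrA; ring.
Qed.

(* If [c + d] has maximal Euclidean norm in [A + B], a second decomposition
   [(c + e) + (d - e)] of it would put both [c + d + e] and [c + d - e] in
   [A + B], contradicting strict convexity of the norm. *)
Lemma unique_sum (A B : seq 'rV[int]_n) : A != [::] -> B != [::] ->
  exists c d, [/\ c \in A, d \in B &
    forall a b, a \in A -> b \in B -> a + b = c + d -> a = c].
Proof.
move=> A0 B0; pose s := [seq (a, b) | a <- A, b <- B].
have s0 : s != [::] by rewrite -size_eq0 size_allpairs muln_eq0 !size_eq0 negb_or A0.
have [[c d] + cdM] := seq_argmax (fun u => sqnorm (u.1 + u.2)) s0.
case/allpairsP => [[c' d']] /= [cA dB [ccE ddE]]; subst c' d'.
exists c, d; split=> // a b aA bB abE; apply/eqP/negPn/negP => ac.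
have in_s u v : u \in A -> v \in B -> sqnorm (u + v) <= sqnorm (c + d).
  by move=> uA vB; apply: (cdM (u, v)); apply/allpairsP; exists (u, v).
have aE : a + d = (c + d) + (a - c) by rewrite [RHS]addrC addrA subrK.
have bE : c + b = (c + d) - (a - c) by rewrite -abE opprB [RHS]addrC addrA subrK.
have := lerD (in_s _ _ aA dB) (in_s _ _ cA bB).
rewrite aE bE sqnorm_parallelogram -mulr2n lerMn2r /= gerDl.
by rewrite leNgt sqnorm_gt0 // subr_eq0.
Qed.

End UniqueSum.

(** Only exponents whose coefficient is not divisible by [p] are kept. If both sets are nonempty,
    [unique_sum] provides an exponent [c + d] at which the product has coefficient [f c * g d]
    modulo [p], against primality in [R]. *)
Lemma laurent_prime (R : comNzRingType) (n p : nat) :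
  (forall x y : R, pdvd p 1 (x * y) -> pdvd p 1 x \/ pdvd p 1 y) ->
  forall f g : laurent R n, pdvd p 1 (f * g) -> pdvd p 1 f \/ pdvd p 1 g.
Proof.
move=> primeR f g fg; apply: contrapT => /not_orP[].
pose A (h : laurent R n) := [seq a <- finsupp h | `[< ~ pdvd p 1 (h a) >]].
have memA h a : a \in A h <-> ~ pdvd p 1 (h a).
  rewrite mem_filter; split=> [/andP[/asboolP//]|ha]; apply/andP; split.
    exact/asboolP.
  by rewrite mem_finsupp; apply/eqP => h0; apply: ha; rewrite h0; exact: pdvd0.
have A_neq0 h : ~ pdvd p 1 h -> A h != [::].
  move=> hN; apply/eqP => A0; apply: hN; apply/laurent_pdvdP => a.
  by apply: contrapT => /memA; rewrite A0.
move=> /A_neq0 Af /A_neq0 Ag.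
have [c [d [/memA fc /memA gd uniq_cd]]] := unique_sum Af Ag.
have : pdvd p 1 (f c * g d); last by case/primeR.
have /laurent_pdvdP/(_ (c + d)) := fg; rewrite laurent_mulE.
have cf : c \in finsupp f.
  by rewrite mem_finsupp; apply/eqP => f0; apply: fc; rewrite f0; exact: pdvd0.
have cdK : c + d - c = d by rewrite addrC addKr.
rewrite (big_fsetD1 c) //= cdK => fgcd.
rewrite -[_ * _](addrK (\sum_(a <- (finsupp f `\ c)%fset) f a * g (c + d - a))).
apply: pdvdB => //; rewrite big_seq; apply: pdvd_sum => a.
rewrite !inE => /andP[ac _].
have [fa|/memA fa] := pselect (pdvd p 1 (f a)); first exact: pdvdMr.
have [ga|/memA ga] := pselect (pdvd p 1 (g (c + d - a))); first exact: pdvdMl.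
by case/eqP: ac; apply: uniq_cd fa ga _; rewrite subrKC.
Qed.

(** * Frobenius lifts as ring morphisms *)

Section IterMorphism.
Variables (R : pzRingType) (phi : {rmorphism R -> R}) (j : nat).

Lemma iter_is_zmod_morphism : zmod_morphism (iter j phi).
Proof. by elim: j => // k IH x y; rewrite !iterS IH rmorphB. Qed.

Lemma iter_is_monoid_morphism : monoid_morphism (iter j phi).
Proof.
split=> [|x y]; elim: j => // k IH; first by rewrite iterS IH rmorph1.
by rewrite !iterS IH rmorphM.
Qed.

HB.instance Definition _ :=
  GRing.isZmodMorphism.Build R R (iter j phi) iter_is_zmod_morphism.
HB.instance Definition _ :=
  GRing.isMonoidMorphism.Build R R (iter j phi) iter_is_monoid_morphism.

End IterMorphism.

Section FrobeniusLift.
Variables (R : comNzRingType) (n : nat) (phi : {rmorphism R -> R}) (q : nat).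
Local Notation L := (laurent R n).
Implicit Types (f g : L) (a b m : 'rV[int]_n) (x : R).

(** One construction serves both twists: [phi] the identity and [q = p] give [sigma], while
    [phi = iter j sigma] and [q = p ^ j] twist the variables t and z together. *)
Definition frob_lift f : L := \sum_(a <- finsupp f) mono (a *+ q) (phi (f a)).

Lemma frob_liftw f (D : {fset 'rV[int]_n}) : (finsupp f `<=` D)%fset ->
  frob_lift f = \sum_(a <- D) mono (a *+ q) (phi (f a)).
Proof.
move=> fD; rewrite /frob_lift (big_fset_incl _ fD) //= => a _ fa.
by rewrite (fsfun_dflt fa) rmorph0 mono0.
Qed.

Lemma frob_liftD f g : frob_lift (f + g) = frob_lift f + frob_lift g.
Proof.
pose D := (finsupp f `|` finsupp g `|` finsupp (f + g)%R)%fset.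
have fD : (finsupp f `<=` D)%fset by rewrite /D -fsetUA fsubsetUl.
have gD : (finsupp g `<=` D)%fset by rewrite /D fsetUAC fsubsetUr.
have fgD : (finsupp (f + g)%R `<=` D)%fset by rewrite /D fsubsetUr.
rewrite (frob_liftw fD) (frob_liftw gD) (frob_liftw fgD) -big_split /=.
by apply: eq_bigr => a _; rewrite laurentD rmorphD monoD.
Qed.

Lemma frob_lift_mono a x : frob_lift (mono a x) = mono (a *+ q) (phi x).
Proof.
by rewrite (frob_liftw (finsupp_mono a x)) big_seq_fset1 monoE eqxx.
Qed.

Lemma frob_lift0 : frob_lift 0 = 0.
Proof. by rewrite -(mono0 R 0) frob_lift_mono rmorph0 !mono0. Qed.

Lemma frob_lift_is_zmod_morphism : zmod_morphism frob_lift.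
Proof.
move=> f g; apply/eqP; rewrite -(inj_eq (addIr (frob_lift g))).
by rewrite -frob_liftD !subrK.
Qed.

Lemma frob_lift_is_monoid_morphism : monoid_morphism frob_lift.
Proof.
split; first by rewrite -[1]mono1 frob_lift_mono mul0rn rmorph1.
move=> f g; move: f; apply: laurent_ind => [|f f' IH IH'|a x].
- by rewrite mul0r frob_lift0 mul0r.
- by rewrite mulrDl !frob_liftD IH IH' mulrDl.
move: g; apply: laurent_ind => [|g g' IH IH'|b y].
- by rewrite mulr0 frob_lift0 mulr0.
- by rewrite mulrDr !frob_liftD IH IH' mulrDr.
by rewrite mulUU !frob_lift_mono mulUU mulrnDl rmorphM.
Qed.

HB.instance Definition _ :=
  GRing.isZmodMorphism.Build L L frob_lift frob_lift_is_zmod_morphism.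
HB.instance Definition _ :=
  GRing.isMonoidMorphism.Build L L frob_lift frob_lift_is_monoid_morphism.

Lemma mul_frob_liftE f g m :
  (f * frob_lift g) m = \sum_(a <- finsupp g) f (m - a *+ q) * phi (g a).
Proof.
rewrite mulr_sumr laurent_sum; apply: eq_bigr => a _.
exact: laurent_mul_monoE.
Qed.

Lemma frob_liftE g m : (0 < q)%N -> frob_lift g (m *+ q) = phi (g m).
Proof.
move=> q_gt0; rewrite laurent_sum.
transitivity (\sum_(a <- finsupp g) if a == m then phi (g a) else 0).
  apply: eq_bigr => a _; rewrite monoE eq_sym; congr (if _ then _ else _).
  apply/eqP/eqP => [/rowP am|->//]; apply/rowP => i; have := am i.
  by rewrite !mulmxnE => /eqP; rewrite eqrMn2r eqn0Ngt q_gt0 => /eqP.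
by rewrite finsupp_sum_eq // => ->; rewrite rmorph0.
Qed.

Lemma frob_lift_supp g m : frob_lift g m != 0 ->
  exists2 a, g a != 0 & m = a *+ q.
Proof.
move=> gm; apply: contrapT => Nex; case/eqP: gm; rewrite laurent_sum.
rewrite big1 // => a _; rewrite monoE; case: eqP => // ma.
have [->|ga] := eqVneq (g a) 0; first by rewrite rmorph0.
by case: Nex; exists a.
Qed.

End FrobeniusLift.

(** Modulo [p] the [p ^ j]-th power is additive, which reduces the claim to monomials; there it is
    the hypothesis on [phi]. *)
Lemma frob_lift_congr (R : comNzRingType) (n p j : nat)
    (phi : {rmorphism R -> R}) : prime p ->
  (forall x, pdvd p 1 (x ^+ (p ^ j) - phi x)) ->
  forall f : laurent R n, pdvd p 1 (f ^+ (p ^ j) - frob_lift phi (p ^ j) f).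
Proof.
move=> p_pr phiP; apply: laurent_ind => [|f g IHf IHg|a x].
- by rewrite rmorph0 expr0n expn_eq0 eqn0Ngt prime_gt0 // subr0; exact: pdvd0.
- rewrite rmorphD; apply: pdvd_trans (pdvdB_add IHf IHg).
  elim: j {phiP IHf IHg} => [|i IH]; first by rewrite subrr; exact: pdvd0.
  rewrite expnSr !exprM; apply: pdvd_trans (pdvd_expD _ _ _) => //.
  exact: pdvdB_exp.
rewrite mono_exp frob_lift_mono /=; apply/laurent_pdvdP => m.
rewrite laurentD laurentN !monoE; case: eqP => _; first exact: phiP.
by rewrite subr0; exact: pdvd0.
Qed.

Section Sigma.
Variables (p : nat) (p_pr : prime p) (n : nat).
Local Notation L := (zlaurent p_pr n).
Local Notation sigma := (@sigma p p_pr n).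

HB.instance Definition _ := GRing.isZmodMorphism.Build L L sigma
  (@frob_lift_is_zmod_morphism (padic_int p_pr) n idfun p).
HB.instance Definition _ := GRing.isMonoidMorphism.Build L L sigma
  (@frob_lift_is_monoid_morphism (padic_int p_pr) n idfun p).

Lemma sigma_iter_congr j (f : L) : pdvd p 1 (f ^+ (p ^ j) - iter j sigma f).
Proof.
have sigma1 g : pdvd p 1 (g ^+ p - sigma g).
  rewrite -[X in _ ^+ X]expn1.
  apply: (@frob_lift_congr _ n p 1 idfun p_pr) => x.
  by rewrite expn1; exact: padic_fermat.
elim: j => [|j IH]; first by rewrite subrr; exact: pdvd0.
by rewrite expnSr exprM iterS; apply: pdvd_trans (sigma1 _); exact: pdvdB_exp.
Qed.

(** The coefficient of [sigma g] at [m *+ p] is that of [g] at [m], so divisibility by [p] descends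
    from [sigma g] to [g]. *)
Lemma sigma_nonzero j (f : L) : ~ pdvd p 1 f -> ~ pdvd p 1 (iter j sigma f).
Proof.
move=> fN; elim: j => // j IH; rewrite iterS; move: (iter j _ f) IH => g gN.
move=> /laurent_pdvdP sg; apply: gN; apply/laurent_pdvdP => m.
by have := sg (m *+ p); rewrite (frob_liftE idfun) ?prime_gt0.
Qed.

End Sigma.

(** * Supports of Laurent polynomials, Minkowski sums and dilations *)

Section Supports.
Variables (R : realType) (r : nat).
Local Notation V := 'rV[R]_r.
Local Open Scope classical_set_scope.

Lemma minkowskiA : associative (@minkowski r R).
Proof.
move=> A B C; apply/seteqP; split=> x /=.
  case=> a aA [_ [b bB [c cC <-]] <-].
  by exists (a + b); [exists a => //; exists b | exists c; rewrite // addrA].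
case=> _ [a aA [b bB <-]] [c cC <-].
by exists a => //; exists (b + c); [exists b => //; exists c | rewrite addrA].
Qed.

Lemma minkowski0x : left_id [set 0] (@minkowski r R).
Proof.
move=> A; apply/seteqP; split=> x /=; first by case=> _ -> [a aA <-]; rewrite add0r.
by move=> xA; exists 0 => //; exists x; rewrite // add0r.
Qed.

Lemma minkowskix0 : right_id [set 0] (@minkowski r R).
Proof.
move=> A; apply/seteqP; split=> x /=; first by case=> a aA [_ -> <-]; rewrite addr0.
by move=> xA; exists x => //; exists 0; rewrite // addr0.
Qed.

HB.instance Definition _ := Monoid.isLaw.Build (set V) [set 0] (@minkowski r R)
  minkowskiA minkowski0x minkowskix0.

Lemma real_vecD (a b : 'rV[int]_r) : real_vec R (a + b) = real_vec R a + real_vec R b.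
Proof. exact: raddfD. Qed.

Lemma real_vecMn (a : 'rV[int]_r) k : real_vec R (a *+ k) = k%:R *: real_vec R a.
Proof. by rewrite scaler_nat; exact: raddfMn. Qed.

Lemma real_vec_inj : injective (real_vec R (r:=r)).
Proof.
move=> a b /matrixP ab; apply/matrixP => i j.
by have := ab i j; rewrite !mxE => /intr_inj.
Qed.

(** The witness is the convex combination of [a] and [b] with weights [k / (k + 1)] and
    [1 / (k + 1)]. *)
Lemma dilateS_convex (S : set V) k (a b : V) : convex_set S -> S a -> S b ->
  exists2 c, S c & k%:R *: a + b = k.+1%:R *: c.
Proof.
move=> cS aS bS; have k1 : k.+1%:R != 0 :> R by rewrite pnatr_eq0.
have t01 : 0 <= (k%:R / k.+1%:R : R) <= 1.
  by rewrite divr_ge0 //= ler_pdivrMr ?ltr0Sn // mul1r ler_nat.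
pose t := Itv01 (proj1 (andP t01)) (proj2 (andP t01)).
exists (conv t (a : convex_lmodType V) b).
  by apply/set_mem/cS; apply/mem_set.
rewrite /conv /= scalerDr !scalerA /unstable.onem mulrBr mulr1 mulrC divfK //.
by rewrite -[k.+1]addn1 natrD [k%:R + 1]addrC addrK scale1r.
Qed.

Variable A : comNzRingType.
Implicit Types (S T : set V) (F G : laurent A r).

Definition supp_in S F := forall v, F v != 0 -> S (real_vec R v).

Lemma supp_inM S T F G :
  supp_in S F -> supp_in T G -> supp_in (minkowski S T) (F * G).
Proof.
move=> SF TG v /laurent_mul_supp[a Fa Ga].
exists (real_vec R a); first exact: SF.
by exists (real_vec R (v - a)); [exact: TG | rewrite -real_vecD subrKC].
Qed.

Lemma supp_in1 : supp_in [set 0] 1.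
Proof.
move=> v; rewrite -[1]mono1 monoE; have [->|] := eqVneq v 0; last by rewrite eqxx.
by move=> _ /=; exact: raddf0.
Qed.

Lemma supp_in0 S : supp_in S 0.
Proof. by move=> v; rewrite laurent0 eqxx. Qed.

Lemma supp_inD S F G : supp_in S F -> supp_in S G -> supp_in S (F + G).
Proof.
move=> SF SG v; rewrite laurentD.
have [->|/SF//] := eqVneq (F v) 0.
by rewrite add0r => /SG.
Qed.

Lemma supp_inB S F G : supp_in S F -> supp_in S G -> supp_in S (F - G).
Proof.
by move=> SF SG; apply: supp_inD => // v; rewrite laurentN oppr_eq0 => /SG.
Qed.

(** Convexity absorbs the [k]-fold sum of [S] into its dilation. Positivity of [k] matters: if [S]
    is empty then [F = 0], and [F ^+ 0 = 1] has an exponent while every dilation of [S] is empty. *)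
Lemma supp_inX S F k : (0 < k)%N -> convex_set S ->
  supp_in S F -> supp_in (dilate k%:R S) (F ^+ k).
Proof.
move=> k0 cS SF; case: k k0 => // k _; elim: k => [|k IH] v.
  by rewrite expr1 => /SF Sv; exists (real_vec R v); rewrite // scale1r.
rewrite exprSr => /laurent_mul_supp[a /IH[x xS xa] /SF Sa].
have [c cS' cE] := dilateS_convex k.+1 cS xS Sa.
by exists c => //; rewrite -cE xa -real_vecD subrKC.
Qed.

Lemma supp_in_prod (I : Type) (s : seq I) (P : pred I)
    (S : I -> set V) (F : I -> laurent A r) :
  (forall i, P i -> supp_in (S i) (F i)) ->
  supp_in (\big[@minkowski r R/[set 0]]_(i <- s | P i) S i) (\prod_(i <- s | P i) F i).
Proof.
move=> SF; apply: (big_rec2 supp_in); first exact: supp_in1.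
by move=> i F' S' Pi; apply: supp_inM; exact: SF.
Qed.

Lemma supp_in_frob_lift S F (phi : {rmorphism A -> A}) q :
  supp_in S F -> supp_in (dilate q%:R S) (frob_lift phi q F).
Proof.
move=> SF v /frob_lift_supp[a /SF Sa ->].
by exists (real_vec R a) => //; rewrite real_vecMn.
Qed.

Lemma dilateM (a b : R) S : dilate a (dilate b S) = dilate (a * b) S.
Proof.
apply/seteqP; split=> x; first by case=> _ [s sS <-] <-; exists s; rewrite // scalerA.
by case=> s sS <-; exists (b *: s); [exists s | rewrite scalerA].
Qed.

End Supports.

Lemma newton_polytope_convex (R : realType) (p : nat) (p_pr : prime p) (r n : nat)
  (F : xlaurent p_pr r n) : convex_set (newton_polytope (R:=R) F).
Proof.
move=> x y t /set_mem xF /set_mem yF; apply/mem_set => B /= [cB FB].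
by apply/set_mem/cB; apply/mem_set; [exact: xF | exact: yF].
Qed.

Lemma supp_in_newton (R : realType) (p : nat) (p_pr : prime p) (r n : nat)
  (F : xlaurent p_pr r n) : supp_in (newton_polytope (R:=R) F) F.
Proof. by move=> v Fv; apply: sub_gen_smallest; exists v. Qed.

(** * Ghost terms of the twisted products *)

Section Ghosts.
Variables (R : realType) (p : nat) (p_pr : prime p) (r n : nat).
Local Notation L := (zlaurent p_pr n).
Local Notation X := (xlaurent p_pr r n).
Local Notation sigma := (@sigma p p_pr n).
Variable Lam : seq X.
Implicit Types (a j k m : nat) (F G : X).

(* [F(x) |-> F(x^(p^j))] in both groups of variables [x = (t, z)]. *)
Definition frobX j : X -> X := frob_lift (iter j sigma) (p ^ j).

HB.instance Definition _ j := GRing.RMorphism.on (frobX j).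

Lemma frobX_congr j F : pdvd p 1 (F ^+ (p ^ j) - frobX j F).
Proof. by apply: frob_lift_congr => // f; exact: sigma_iter_congr. Qed.

Local Notation T a m := (twisted_prod Lam a (a + m)).

(** The weights are counted from [a] even when the range starts at [b], so that adjacent ranges add
    up; [b = a] gives the sums of the admissibility condition. *)
Definition polytope_sum a b c : set 'rV[R]_r :=
  \big[@minkowski r R/[set 0]%classic]_(b <= k < c)
    dilate (p ^ (k - a))%:R (newton_polytope Lam`_k).

Lemma polytope_sum_cat a b c d : (b <= c)%N -> (c <= d)%N ->
  polytope_sum a b d = minkowski (polytope_sum a b c) (polytope_sum a c d).
Proof. by move=> bc cd; rewrite /polytope_sum (big_cat_nat bc cd). Qed.

Lemma twisted_prod0 a : T a 0 = 1.
Proof. by rewrite /twisted_prod addn0 big_geq. Qed.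

Lemma twisted_prodS a m : T a m.+1 = T a m * Lam`_(a + m) ^+ (p ^ m).
Proof.
by rewrite /twisted_prod addnS (big_nat_recr _ _ _ (leq_addr m a)) addKn.
Qed.

(** Twisting by [p ^ j] turns the weights counted from [a + j] into weights counted from [a]. *)
Lemma supp_in_frobX_twisted a j b c : (a + j <= b)%N ->
  supp_in (polytope_sum a b c)
    (frobX j (\prod_(b <= k < c) Lam`_k ^+ (p ^ (k - (a + j))))).
Proof.
move=> ab; rewrite rmorph_prod /polytope_sum.
rewrite [X in supp_in X _]big_nat_cond [X in supp_in _ X]big_nat_cond.
apply: supp_in_prod => k /andP[/andP[bk _] _].
have -> : (k - a = j + (k - (a + j)))%N by lia.
rewrite expnD natrM -dilateM; apply: supp_in_frob_lift; apply: supp_inX.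
- by rewrite expn_gt0 prime_gt0.
- exact: newton_polytope_convex.
- exact: supp_in_newton.
Qed.

Lemma frobX0 F : frobX 0 F = F.
Proof.
by rewrite /frobX /frob_lift [RHS](laurent_expand (fsubset_refl _)).
Qed.

Lemma supp_in_twisted a m : supp_in (polytope_sum a a (a + m)) (T a m).
Proof.
have := @supp_in_frobX_twisted a 0 a (a + m); rewrite addn0 frobX0.
exact.
Qed.

(** Appending the polynomial of index [a + m] multiplies the [j]-th term by the [p ^ (m - j.+1)]-th
    power of its [p ^ j.+1]-th power on one side, and of its Frobenius twist on the other. These
    agree modulo [p ^ (m - j)], and [G j] supplies [p ^ j]. *)
Lemma ghost_step_pdvd a m (G : nat -> X) :
  (forall j, (j < m)%N -> pdvd p j (G j)) ->
  T a m = \sum_(j < m) G j * frobX j.+1 (T (a + j.+1) (m - j.+1)) ->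
  pdvd p m (T a m.+1 - \sum_(j < m) G j * frobX j.+1 (T (a + j.+1) (m - j))).
Proof.
move=> Gp TE; rewrite twisted_prodS TE mulr_suml -sumrB; apply: pdvd_sum => j _.
have jm := ltn_ord j.
have -> : (m - j = (m - j.+1).+1)%N by lia.
rewrite twisted_prodS rmorphM mulrA -mulrBr.
have -> : (a + j.+1 + (m - j.+1) = a + m)%N by lia.
have -> : Lam`_(a + m) ^+ (p ^ m)
    = (Lam`_(a + m) ^+ (p ^ j.+1)) ^+ (p ^ (m - j.+1)).
  by rewrite -exprM -expnD subnKC.
have mE : (m = j + (m - j.+1).+1)%N by lia.
rewrite rmorphXn [X in pdvd _ X _]mE.
apply: pdvdM; first by apply/pdvdMr/Gp.
by apply: pdvd_exp_pn; exact: frobX_congr.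
Qed.

Lemma ghosts a m : exists G : nat -> X,
  [/\ forall j, (j < m)%N -> pdvd p j (G j),
      forall j, (j < m)%N -> supp_in (polytope_sum a a (a + j.+1)) (G j) &
      forall k, (k < m)%N -> T a k.+1 =
        \sum_(j < k.+1) G j * frobX j.+1 (T (a + j.+1) (k - j))].
Proof.
elim: m => [|m [G [Gp Gs GT]]]; first by exists (fun=> 0); split.
(* The new ghost term [G m], chosen to make the expansion of [T a m.+1] exact. *)
pose g := T a m.+1 - \sum_(j < m) G j * frobX j.+1 (T (a + j.+1) (m - j)).
pose G' j := if (j < m)%N then G j else g.
(* The induction hypothesis expands only products of positive length; for [m = 0] the divisibility
   of [g] by [p ^ 0] is trivial. *)
have GT0 : (0 < m)%N ->
    T a m = \sum_(j < m) G j * frobX j.+1 (T (a + j.+1) (m - j.+1)).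
  by case: (m) GT => // k GT _; rewrite (GT k).
have gp : pdvd p m g.
  case: (posnP m) => [m0|/GT0]; last exact: ghost_step_pdvd.
  by rewrite /g m0; exact: pdvd_n0.
have gs : supp_in (polytope_sum a a (a + m.+1)) g.
  apply: supp_inB; first exact: supp_in_twisted.
  apply: (big_ind (supp_in _)); [exact: supp_in0 | exact: supp_inD |] => j _.
  have jm := ltn_ord j.
  (* Indices up to [a + j] account for [G j], the later ones for the twisted factor. *)
  rewrite (@polytope_sum_cat _ _ (a + j.+1)); [|lia..].
  apply: supp_inM; first exact: Gs.
  have -> : (a + m.+1 = a + j.+1 + (m - j))%N by lia.
  exact: supp_in_frobX_twisted.
exists G'; split=> k; rewrite ltnS leq_eqVlt => /predU1P[->|km].
- by rewrite /G' ltnn.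
- by rewrite /G' km; exact: Gp.
- by rewrite /G' ltnn.
- by rewrite /G' km; exact: Gs.
- rewrite big_ord_recr /= /G' ltnn subnn twisted_prod0 rmorph1 mulr1.
  rewrite (eq_bigr (fun j : 'I_m => G j * frobX j.+1 (T (a + j.+1) (m - j)))).
    by rewrite subrKC.
  by move=> j _; rewrite ltn_ord.
- rewrite (GT k km); apply: eq_bigr => j _; rewrite /G' ifT //.
  by have := ltn_ord j; lia.
Qed.

Variable Delta : {fset 'rV[int]_r}.
Local Notation H m F := (hasse_witt Delta m F).

(** The entry of the product is a sum over exponents [e] of [F], in which [G] is taken at
    [w *+ p ^ j - u] with [w = v *+ p ^ m - e]. The second hypothesis forces [w] into [Delta] when
    that coefficient of [G] is nonzero; what remains is a matrix product over [w]. *)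
Lemma hasse_witt_mul_frobX j m (S : set 'rV[R]_r) G F : supp_in S G ->
  (forall u w, u \in Delta -> S (real_vec R (w *+ p ^ j - u)) -> w \in Delta) ->
  H (j + m) (G * frobX j F) = H j G *m sigma_mx j (H m F).
Proof.
move=> GS adm; apply/matrixP => u v; rewrite !mxE mul_frob_liftE.
have uD : Delta`_u \in Delta by rewrite mem_nth.
set e0 := Delta`_v *+ p ^ m.
(* For each [e] at most one index [w] satisfies the test, as the entries of [Delta] are distinct; if
   there is none, the coefficient of [G] vanishes. *)
transitivity (\sum_(e <- finsupp F) \sum_(w < #|` Delta|)
    if e == e0 - Delta`_w then
      G (Delta`_w *+ p ^ j - Delta`_u) * iter j sigma (F e) else 0).
  apply: eq_bigr => e _.
  have eE : Delta`_v *+ p ^ (j + m) - Delta`_u - e *+ p ^ j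
      = (e0 - e) *+ p ^ j - Delta`_u.
    by rewrite addrAC mulrnBl /e0 -mulrnA mulnC -expnD.
  rewrite eE; have [eD|eD] := boolP (e0 - e \in Delta).
    have wP : (index (e0 - e)%R Delta < #|` Delta|)%N by rewrite index_mem.
    rewrite (bigD1 (Ordinal wP)) //= nth_index // subKr eqxx big1 ?addr0 //.
    move=> w; rewrite -val_eqE /= => wN; case: eqP => // eE'; case/eqP: wN.
    by rewrite eE' subKr index_uniq ?fset_uniq.
  rewrite big1 => [|w _]; last first.
    by case: eqP => // eE'; case/negP: eD; rewrite eE' subKr mem_nth.
  have [->|/GS/(adm _ _ uD) De] := eqVneq (G ((e0 - e) *+ p ^ j - Delta`_u)) 0.
    by rewrite mul0r.
  by rewrite De in eD.
rewrite exchange_big /=; apply: eq_bigr => w _; rewrite !mxE.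
by rewrite finsupp_sum_eq // => ->; rewrite rmorph0 mulr0.
Qed.

Lemma hasse_witt0 : H 0 (1 : X) = 1%:M.
Proof.
apply/matrixP => u v; rewrite !mxE expn0 mulr1n -[1]mono1 monoE subr_eq0.
have -> : (Delta`_v == Delta`_u) = (u == v).
  by rewrite nth_uniq ?fset_uniq // eq_sym.
by case: (u == v).
Qed.

End Ghosts.

(** * Congruences between matrix fractions *)

Section MatrixFractions.
Variables (L : comNzRingType) (p g : nat).
Implicit Types (M N X Y Z : 'M[L]_g) (k s : nat) (d : L).

Definition mxpdvd k M := forall i j, pdvd p k (M i j).

Lemma mxpdvd_n0 M : mxpdvd 0 M.
Proof. by move=> i j; exact: pdvd_n0. Qed.
Lemma mxpdvd0 k : mxpdvd k 0.
Proof. by move=> i j; rewrite mxE; exact: pdvd0. Qed.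
Lemma mxpdvdD k M N : mxpdvd k M -> mxpdvd k N -> mxpdvd k (M + N).
Proof. by move=> Mk Nk i j; rewrite mxE; exact: pdvdD. Qed.
Lemma mxpdvdN k M : mxpdvd k M -> mxpdvd k (- M).
Proof. by move=> Mk i j; rewrite mxE; exact: pdvdN. Qed.
Lemma mxpdvdZ k d M : mxpdvd k M -> mxpdvd k (d *: M).
Proof. by move=> Mk i j; rewrite mxE; exact: pdvdMl. Qed.
Lemma mxpdvd_sum k (I : Type) (s : seq I) (P : pred I) (F : I -> 'M[L]_g) :
  (forall i, P i -> mxpdvd k (F i)) -> mxpdvd k (\sum_(i <- s | P i) F i).
Proof. by move=> PF; apply: big_ind => //; [exact: mxpdvd0 | exact: mxpdvdD]. Qed.
Lemma mxpdvdW k l M : (k <= l)%N -> mxpdvd l M -> mxpdvd k M.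
Proof. by move=> kl Ml i j; exact: pdvdW (Ml i j). Qed.
Lemma mxpdvdM k l M N : mxpdvd k M -> mxpdvd l N -> mxpdvd (k + l) (M *m N).
Proof.
by move=> Mk Nl i j; rewrite mxE; apply: pdvd_sum => h _; exact: pdvdM.
Qed.
Lemma mxpdvdMr k M N : mxpdvd k M -> mxpdvd k (M *m N).
Proof. by move=> Mk; rewrite -[k]addn0; apply: mxpdvdM => //; exact: mxpdvd_n0. Qed.
Lemma mxpdvdMl k M N : mxpdvd k N -> mxpdvd k (M *m N).
Proof. by move=> Nk; rewrite -[k]add0n; apply: mxpdvdM => //; exact: mxpdvd_n0. Qed.
Lemma mxpdvdB_mul k M M' N N' :
  mxpdvd k (M - M') -> mxpdvd k (N - N') -> mxpdvd k (M *m N - M' *m N').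
Proof.
move=> MM NN; have -> : M *m N - M' *m N' = (M - M') *m N + M' *m (N - N').
  by rewrite mulmxBl mulmxBr addrA subrK.
by apply: mxpdvdD; [exact: mxpdvdMr | exact: mxpdvdMl].
Qed.
Lemma mxpdvd_trans k X Y Z :
  mxpdvd k (X - Y) -> mxpdvd k (Y - Z) -> mxpdvd k (X - Z).
Proof. by move=> XY YZ; rewrite -(subrKA Y); exact: mxpdvdD. Qed.

Lemma mxpdvd_det k M N : mxpdvd k (M - N) -> pdvd p k (\det M - \det N).
Proof.
move=> MN; rewrite /determinant.
apply: (big_ind2 (fun x y => pdvd p k (x - y))) => [||s _].
- by rewrite subrr; exact: pdvd0.
- by move=> x x' y y'; exact: pdvdB_add.
rewrite -mulrBr; apply: pdvdMl.
apply: (big_ind2 (fun x y => pdvd p k (x - y))) => [||i _].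
- by rewrite subrr; exact: pdvd0.
- by move=> x x' y y'; exact: pdvdB_mul.
by have := MN i (perm.fun_of_perm s i); rewrite !mxE.
Qed.

Lemma mxpdvd_map k M (f : {rmorphism L -> L}) :
  mxpdvd k M -> mxpdvd k (map_mx f M).
Proof. by move=> Mk i j; rewrite mxE; exact: pdvd_rmorph. Qed.

(* [X Y^-1 = X' Y'^-1] modulo [p ^ k], denominators cleared by Cramer's rule. *)
Definition frac_eqp k X Y X' Y' :=
  mxpdvd k (\det Y' *: (X *m \adj Y) - \det Y *: (X' *m \adj Y')).

Lemma frac_eqp_refl k X X' : frac_eqp k X X X' X'.
Proof.
rewrite /frac_eqp !mul_mx_adj !scale_scalar_mx mulrC subrr; exact: mxpdvd0.
Qed.

Lemma frac_eqpW k l X Y X' Y' : (k <= l)%N ->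
  frac_eqp l X Y X' Y' -> frac_eqp k X Y X' Y'.
Proof. exact: mxpdvdW. Qed.

Lemma frac_eqp_map k X Y X' Y' (f : {rmorphism L -> L}) :
  frac_eqp k X Y X' Y' ->
  frac_eqp k (map_mx f X) (map_mx f Y) (map_mx f X') (map_mx f Y').
Proof.
move=> /(mxpdvd_map f).
by rewrite /frac_eqp !(map_mxB, map_mxZ, map_mxM, map_mx_adj, det_map_mx).
Qed.

Hypothesis cancel_p : forall k d x,
  ~ pdvd p 1 d -> pdvd p k (d * x) -> pdvd p k x.

Lemma mxpdvd_cancel k d M : ~ pdvd p 1 d -> mxpdvd k (d *: M) -> mxpdvd k M.
Proof.
by move=> dN dM i j; apply: cancel_p dN _; have := dM i j; rewrite mxE.
Qed.

(** Multiplying the assumed difference [D] by [Y *m \adj X] on the left and [Y' *m \adj X'] on the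
    right leaves minus the wanted difference, scaled by [\det Y * \det Y']; both determinants are
    then cancelled. *)
Lemma frac_eqp_inv k X Y X' Y' : ~ pdvd p 1 (\det Y) -> ~ pdvd p 1 (\det Y') ->
  frac_eqp k X Y X' Y' -> frac_eqp k Y X Y' X'.
Proof.
move=> YN YN'; rewrite /frac_eqp; set D := (D in mxpdvd k D) => Dk.
apply: mxpdvd_cancel YN _; apply: mxpdvd_cancel YN' _.
have YDX : Y *m (\adj X *m D *m Y') *m \adj X' =
    \det Y' *: (\det Y *: (\det X *: (Y' *m \adj X') - \det X' *: (Y *m \adj X))).
  have -> : \adj X *m D *m Y' =
      \det Y' *: (\det X *: (\adj Y *m Y') - \det Y *: (\adj X *m X')).
    rewrite /D mulmxBr -!scalemxAr !mulmxA mul_adj_mx mul_scalar_mx.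
    rewrite mulmxBl -!scalemxAl -(mulmxA _ (\adj Y')) mul_adj_mx mul_mx_scalar.
    by rewrite scalerBr !scalerA [\det Y * _]mulrC.
  rewrite -scalemxAr -scalemxAl mulmxBr mulmxBl -!scalemxAr -!scalemxAl.
  rewrite mulmxA mul_mx_adj mul_scalar_mx -scalemxAl mulmxA -(mulmxA _ X').
  rewrite mul_mx_adj mul_mx_scalar.
  rewrite !(scalerBr, scalerA).
  by congr (_ *: _ - _); ring.
rewrite [X in mxpdvd k X](_ : _ = - (Y *m (\adj X *m D *m Y') *m \adj X')).
  by apply/mxpdvdN/mxpdvdMr/mxpdvdMl/mxpdvdMr/mxpdvdMl.
by rewrite YDX -[RHS]scalerN -[X in _ = _ *: X]scalerN opprB.
Qed.

(** In the product of the two congruences the inner factors [\adj Y *m Y] and [\adj Y' *m Y'] become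
    determinants, which are cancelled. *)
Lemma frac_eqp_trans k X Y Z X' Y' Z' :
  ~ pdvd p 1 (\det Y) -> ~ pdvd p 1 (\det Y') ->
  frac_eqp k X Y X' Y' -> frac_eqp k Y Z Y' Z' -> frac_eqp k X Z X' Z'.
Proof.
move=> YN YN' XY YZ; have := mxpdvdB_mul XY YZ; rewrite /frac_eqp => XYZ.
apply: mxpdvd_cancel YN _; apply: mxpdvd_cancel YN' _.
rewrite [X in mxpdvd k X](_ : _ = (\det Y' *: (X *m \adj Y)) *m
  (\det Z' *: (Y *m \adj Z)) - (\det Y *: (X' *m \adj Y')) *m
  (\det Z *: (Y' *m \adj Z'))) //.
have mul_adj_mid M N P : M *m \adj N *m (N *m P) = \det N *: (M *m P).
  by rewrite mulmxA -(mulmxA M) mul_adj_mx mul_mx_scalar scalemxAl.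
rewrite -!(scalemxAl, scalemxAr) !mul_adj_mid !scalerBr !scalerA.
by congr (_ *: _ - _ *: _); ring.
Qed.

End MatrixFractions.

(** * Dwork congruences for a family of matrices with a ghost expansion *)

Section DworkCongruences.
Variables (L : comNzRingType) (p g l : nat) (phi : {rmorphism L -> L}).
Variable H : nat -> nat -> 'M[L]_g.
Implicit Types (a j k m s : nat).
Local Notation tw j M := (map_mx (iter j phi) M : 'M[L]_g).

Hypothesis H0 : forall a, H a 0 = 1%:M.
Hypothesis H_ghost : forall a m, (a + m <= l.+1)%N -> exists B : nat -> 'M[L]_g,
  (forall j, (j < m)%N -> mxpdvd p j (B j)) /\
  (forall k, (k < m)%N ->
     H a k.+1 = \sum_(j < k.+1) B j *m tw j.+1 (H (a + j.+1) (k - j))).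

(** Modulo [p] only the term with [B 0] survives, and the expansion of length one identifies [B 0]
    with [H a 1]. *)
Lemma dwork_congr1 a m : (a + m.+1 <= l.+1)%N ->
  mxpdvd p 1 (H a m.+1 - H a 1 *m tw 1 (H a.+1 m)).
Proof.
move=> aml; have [B [Bp HE]] := H_ghost aml.
rewrite (HE m) // (HE 0%N) // big_ord1 big_ord_recl subn0 H0 map_mx1 mulmx1 addn1.
rewrite addrC addKr; apply: mxpdvd_sum => j _; apply: mxpdvdMr.
by apply: mxpdvdW (Bp _ _) => //; rewrite /bump /= add1n ltnS ltn_ord.
Qed.

Lemma dwork_congr_prod a m : (a + m <= l.+1)%N ->
  mxpdvd p 1 (H a m - \prod_(0 <= i < m) tw i (H (a + i) 1)).
Proof.
elim: m a => [|m IH] a aml.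
  by rewrite big_geq // H0 subrr; exact: mxpdvd0.
apply: mxpdvd_trans (dwork_congr1 aml) _.
rewrite big_nat_recl // addn0.
rewrite (_ : \prod_(0 <= i < m) _ = tw 1 (\prod_(0 <= i < m) tw i (H (a.+1 + i) 1))).
  rewrite (_ : tw 0 (H a 1) = H a 1); last by apply/matrixP => i j; rewrite mxE.
  apply: mxpdvdB_mul; first by rewrite subrr; exact: mxpdvd0.
  by rewrite -map_mxB; apply: mxpdvd_map; apply: IH; rewrite addSnnS.
rewrite (big_morph (map_mx (iter 1 phi)) (@map_mxM _ _ _ _ _ _) (map_mx1 _ _)).
apply: eq_bigr => i _; rewrite addSnnS.
by apply/matrixP => u v; rewrite !mxE.
Qed.

Hypothesis cancel_p : forall k (d x : L),
  ~ pdvd p 1 d -> pdvd p k (d * x) -> pdvd p k x.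
Hypothesis phi_nonzero : forall x, ~ pdvd p 1 x -> ~ pdvd p 1 (phi x).
Hypothesis detH1 : forall a, (a <= l)%N -> ~ pdvd p 1 (\det (H a 1)).

Lemma iter_nonzero j x : ~ pdvd p 1 x -> ~ pdvd p 1 (iter j phi x).
Proof. by move=> xN; elim: j => //= j; exact: phi_nonzero. Qed.

(** Modulo [p], [dwork_congr1] splits off [\det (H a 1)], which [cancel_p] removes; the other factor
    is the twist of a determinant covered by induction, and [phi] preserves indivisibility. *)
Lemma dwork_det a m : (a + m <= l.+1)%N -> ~ pdvd p 1 (\det (H a m)).
Proof.
elim: m a => [|m IH] a aml.
  (* If [p] divided 1, it would divide [\det (H 0 1)]. *)
  rewrite H0 det1 => p1; apply: (detH1 (leq0n l)).
  by rewrite -[\det _]mul1r; exact: pdvdMr.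
have aml1 : (a <= l)%N by lia.
have aml' : (a.+1 + m <= l.+1)%N by lia.
move=> Hp; have /(pdvdB Hp) := mxpdvd_det (dwork_congr1 aml).
rewrite subKr det_mulmx det_map_mx => /(cancel_p (detH1 aml1)).
exact: (@iter_nonzero 1 _ (IH _ aml')).
Qed.

(** The induction on [s] keeps [a] general, since the links of the chain are instances with smaller
    [s] and larger starting index. *)
Lemma dwork_frac s a : (0 < s)%N -> (a + s <= l)%N ->
  frac_eqp p s (H a s.+1) (tw 1 (H a.+1 s)) (H a s) (tw 1 (H a.+1 s.-1)).
Proof.
elim/ltn_ind: s a => -[//|t] IH a _ asl.
pose C i := tw i (H (a + i) (t.+2 - i)).
pose D i := tw i (H (a + i) (t.+1 - i)).
have CD_N i : (i <= t.+1)%N -> ~ pdvd p 1 (\det (C i)) /\ ~ pdvd p 1 (\det (D i)).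
  by move=> it; split; rewrite det_map_mx; apply/iter_nonzero/dwork_det; lia.
(* The composed quotients [C j.+1] over [C 1]; each further link costs one power of [p] in the
   modulus. *)
have CD1 j : (j <= t)%N -> frac_eqp p (t.+1 - j) (C j.+1) (C 1) (D j.+1) (D 1).
  elim: j => [_|j IHj jt]; first exact: frac_eqp_refl.
  have [CN DN] := CD_N j.+1 (leqW jt).
  apply: frac_eqp_trans CN DN _ _ => //; last first.
    by apply: frac_eqpW (IHj (ltnW jt)); lia.
  apply: frac_eqp_inv => //.
    by case: (CD_N j.+2).
    by case: (CD_N j.+2).
  have tj : (t.+1 - j.+1 < t.+1)%N by lia.
  have tj0 : (0 < t.+1 - j.+1)%N by lia.
  have tjl : (a + j.+1 + (t.+1 - j.+1) <= l)%N by lia.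
  (* The link between [C j.+1] and [C j.+2] is the twist by [iter j.+1 phi] of the induction
     hypothesis started at [a + j.+1]. *)
  have := frac_eqp_map (iter j.+1 phi) (IH _ tj _ tj0 tjl).
  have tw_iter M : tw j.+1 (tw 1 M) = tw j.+2 M.
    by apply/matrixP => u v; rewrite !mxE -iterD addn1.
  rewrite !tw_iter /C /D.
  have -> : (t.+2 - j.+1 = (t.+1 - j.+1).+1)%N by lia.
  have -> : (t.+2 - j.+2 = t.+1 - j.+1)%N by lia.
  have -> : (t.+1 - j.+2 = (t.+1 - j.+1).-1)%N by lia.
  by rewrite !addnS.
have alm : (a + t.+2 <= l.+1)%N by lia.
have [B [Bp HE]] := H_ghost alm.
have HC : H a t.+2 = \sum_(j < t.+1) B j *m C j.+1 + B t.+1 *m C t.+2.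
  by rewrite (HE t.+1) // big_ord_recr.
have HD : H a t.+1 = \sum_(j < t.+1) B j *m D j.+1 by rewrite (HE t).
have -> : tw 1 (H a.+1 t.+1) = C 1 by rewrite /C addn1.
have -> : tw 1 (H a.+1 t.+1.-1) = D 1 by rewrite /D addn1 subn1.
(* The ghost term of index [t.+1] has no counterpart in [H a t.+1], but it is divisible by
   [p ^ t.+1]. *)
rewrite /frac_eqp HC HD mulmxDl scalerDr addrAC; apply: mxpdvdD; last first.
  by apply/mxpdvdZ/mxpdvdMr/mxpdvdMr/Bp.
rewrite !mulmx_suml !scaler_sumr -sumrB; apply: mxpdvd_sum => j _.
have jt := ltn_ord j.
rewrite -!mulmxA !(scalemxAr _ (B j)) -mulmxBr.
(* [B j] supplies [p ^ j], and [CD1] the remaining [p ^ (t.+1 - j)]. *)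
have {1}-> : (t.+1 = j + (t.+1 - j))%N by lia.
apply: mxpdvdM; first by apply: Bp; lia.
by apply: CD1; lia.
Qed.

End DworkCongruences.

(** * Congruences of Laurent polynomials as divisibility *)

Section Bridge.
Variables (p : nat) (p_pr : prime p) (n : nat).
Implicit Types f g : zlaurent p_pr n.

Lemma eqmodP s f g : eqmod s f g <-> pdvd p s (f - g).
Proof. exact: iff_sym (laurent_pdvdP _ _ _). Qed.

Lemma nonzero_modpP f : nonzero_modp f <-> ~ pdvd p 1 f.
Proof. by rewrite /nonzero_modp (propext (eqmodP 1 f 0)) subr0. Qed.

Lemma eqmod_mxP s m (M N : 'M[zlaurent p_pr n]_m) :
  eqmod_mx s M N <-> mxpdvd p s (M - N).
Proof.
split=> MN i j; first by rewrite !mxE; exact: (eqmodP _ _ _).1 (MN i j).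
by apply: (eqmodP _ _ _).2; have := MN i j; rewrite !mxE.
Qed.

(** In the p-adic integers [p] is prime and regular, and both properties pass to Laurent
    polynomials. *)
Lemma zlaurent_cancel k f g : ~ pdvd p 1 f -> pdvd p k (f * g) -> pdvd p k g.
Proof.
apply: pdvd_cancel; last by apply: laurent_prime; exact: padic_prime.
by apply: laurent_natr_reg; exact: padic_natr_reg.
Qed.

End Bridge.

(** * Ghost expansion of the Hasse-Witt matrices, from admissibility *)

Section HasseWittGhost.
Variables (R : realType) (p : nat) (p_pr : prime p) (r n : nat).
Variables (Delta : {fset 'rV[int]_r}) (l : nat).
Variable Lam : l.+1.-tuple (xlaurent p_pr r n).
Hypothesis Lam_adm : admissible_polys R Delta Lam.

(** Adding [u] to the given point of the polytope sum gives [w *+ p ^ j.+1]. Admissibility places it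
    in the dilation of [Delta] by [p ^ j.+1], and the nonzero factor cancels. *)
Lemma admissible_mem a j u w : (a + j < l)%N -> u \in Delta ->
  polytope_sum (R:=R) Lam a a (a + j.+1) (real_vec R (w *+ p ^ j.+1 - u)) ->
  w \in Delta.
Proof.
move=> ajl uD Sw.
have adm := Lam_adm (leq_addr j a) ajl; rewrite addKn in adm.
have [] := adm (real_vec R (w *+ p ^ j.+1)).
  split.
    exists (real_vec R u); first by exists u.
    exists (real_vec R (w *+ p ^ j.+1 - u)); last by rewrite -real_vecD subrKC.
    rewrite /weighted_sum -addnS; move: Sw; rewrite /polytope_sum.
    rewrite (eq_big_nat _ _ (F2 := fun k => dilate (p ^ (k - a))%:R
      (nth set0 [tuple of map (newton_polytope (R:=R)) Lam] k))) //.
    by move=> k /andP[_ kj]; rewrite (nth_map 0) // size_tuple; lia.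
  by exists (real_vec R w); [exists w | rewrite real_vecMn].
move=> _ [u' u'D <-] /eqP; rewrite real_vecMn.
rewrite -subr_eq0 -scalerBr scaler_eq0 pnatr_eq0 expn_eq0 eqn0Ngt prime_gt0 //=.
by rewrite subr_eq0 => /eqP/real_vec_inj <-.
Qed.

Local Notation H a m := (hasse_witt Delta m (twisted_prod Lam a (a + m))).

Lemma hasse_witt_sum (I : Type) (s : seq I) m (F : I -> xlaurent p_pr r n) :
  hasse_witt Delta m (\sum_(i <- s) F i) = \sum_(i <- s) hasse_witt Delta m (F i).
Proof.
apply/matrixP => u v; rewrite summxE mxE laurent_sum.
by apply: eq_bigr => i _; rewrite mxE.
Qed.

Lemma hasse_witt_ghost a m : (a + m <= l.+1)%N ->
  exists B : nat -> 'M[zlaurent p_pr n]_(#|` Delta|),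
  (forall j, (j < m)%N -> mxpdvd p j (B j)) /\
  (forall k, (k < m)%N ->
     H a k.+1 = \sum_(j < k.+1) B j *m
       map_mx (iter j.+1 (@sigma p p_pr n)) (H (a + j.+1) (k - j))).
Proof.
move=> aml; have [G [Gp Gs GT]] := ghosts R Lam a m.
exists (fun j => hasse_witt Delta j.+1 (G j)); split=> [j jm|k km].
  by move=> u v; rewrite mxE; have /laurent_pdvdP := Gp j jm; exact.
rewrite (GT k km) hasse_witt_sum; apply: eq_bigr => j _.
(* Admissibility is available only while [a + j < l], whereas [a + k] may equal [l]. The last term
   [j = k] is therefore treated apart: its twisted factor is 1. *)
have := ltn_ord j; rewrite ltnS leq_eqVlt => /predU1P[->|jk].
  rewrite subnn twisted_prod0 rmorph1 mulr1 hasse_witt0.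
  by rewrite map_mx1 mulmx1.
have kE : (k.+1 = j.+1 + (k - j))%N by lia.
rewrite [X in hasse_witt _ X (_ * _)]kE.
have jm : (j < m)%N by exact: ltn_trans km.
rewrite (hasse_witt_mul_frobX _ _ (Gs _ jm)) // => u w.
by apply: admissible_mem; lia.
Qed.

End HasseWittGhost.

Theorem theorem2p6 (R : realType) (p : nat) (p_pr : prime p) (p_odd : odd p)
    (r n : nat) (Delta : {fset 'rV[int]_r}) (l : nat)
    (Lam : l.+1.-tuple (xlaurent p_pr r n)) :
  admissible_polys R Delta Lam ->
  (forall s : nat, (s <= l)%N ->
     eqmod_mx 1
       (hasse_witt Delta s.+1 (twisted_prod Lam 0 s.+1))
       (\prod_(0 <= i < s.+1) sigma_mx i (hasse_witt Delta 1 Lam`_i)))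
  /\
  ((forall i : nat, (i <= l)%N ->
      nonzero_modp (\det (hasse_witt Delta 1 Lam`_i))) ->
   forall s : nat, (1 <= s)%N -> (s <= l)%N ->
     nonzero_modp (\det (hasse_witt Delta s (twisted_prod Lam 1 s.+1)))
     /\
     frac_eqmod s
       (hasse_witt Delta s.+1 (twisted_prod Lam 0 s.+1))
       (sigma_mx 1 (hasse_witt Delta s (twisted_prod Lam 1 s.+1)))
       (hasse_witt Delta s (twisted_prod Lam 0 s))
       (if s == 1%N then 1%:M
        else sigma_mx 1 (hasse_witt Delta s.-1 (twisted_prod Lam 1 s)))).
Proof.
move=> Lam_adm.
pose H a m := hasse_witt Delta m (twisted_prod Lam a (a + m)).
have H0 a : H a 0 = 1%:M by rewrite /H twisted_prod0 hasse_witt0.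
have H1 a : H a 1 = hasse_witt Delta 1 Lam`_a.
  by rewrite /H twisted_prodS twisted_prod0 mul1r addn0 expn0 expr1.
have H_ghost := hasse_witt_ghost Lam_adm.
split=> [s sl|detN s s0 sl].
  apply/eqmod_mxP; have := dwork_congr_prod H0 H_ghost (sl : (0 + s.+1 <= l.+1)%N).
  congr (mxpdvd _ _ (_ - _)); apply: eq_bigr => i _; first by rewrite H1.
have det1 a : (a <= l)%N -> ~ pdvd p 1 (\det (H a 1)).
  by move=> al; rewrite H1; apply/nonzero_modpP; exact: detN.
have cancel_p := @zlaurent_cancel p p_pr n.
have sigmaN := @sigma_nonzero p p_pr n 1.
have detN' a m : (a + m <= l.+1)%N -> ~ pdvd p 1 (\det (H a m)).
  exact: (dwork_det H0 H_ghost cancel_p sigmaN det1).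
(* The convention for [s = 1] agrees with the general formula, as [H 1 0] is the identity. *)
have -> : (if s == 1%N then 1%:M
    else sigma_mx 1 (hasse_witt Delta s.-1 (twisted_prod Lam 1 s))) =
    sigma_mx 1 (H 1 s.-1).
  case: eqP => [->|_]; first by rewrite H0 /sigma_mx map_mx1.
  by rewrite /H add1n prednK.
split; first by apply/nonzero_modpP; apply: (detN' 1).
split.
- by rewrite det_map_mx; apply/nonzero_modpP/sigmaN/(detN' 1).
- by rewrite det_map_mx; apply/nonzero_modpP/sigmaN/(detN' 1); lia.
apply/eqmod_mxP.
exact: (dwork_frac H0 H_ghost cancel_p sigmaN det1 s0 (sl : (0 + s <= l)%N)).
Qed.
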